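(* For every real $x>0$, $$\psi'(x)>\frac{e^{1/x}}{\bigl(e^{1/x}-1\bigr)x^2} \quad\text{and}\quad \psi''(x)<\frac{e^{1/x}\bigl[1-2x\bigl(e^{1/x}-1\bigr)\bigr]} {\bigl(e^{1/x}-1\bigr)^2x^4}.$$
   Context: $\Gamma$ is Euler's gamma function and $\psi(x)=\Gamma'(x)/\Gamma(x)$ is the psi (digamma) function; $\psi'$ and $\psi''$ are its first and second derivatives (the trigamma and tetragamma functions). *)

(* Defs.v *)
From HB Require Import structures.
From mathcomp Require Import all_boot all_order all_algebra.
From mathcomp Require Import all_classical all_reals all_analysis.

Set Implicit Arguments.
Unset Strict Implicit.
Unset Printing Implicit Defensive.

Import Order.TTheory GRing.Theory Num.Theory.
Import numFieldNormedType.Exports.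

Local Open Scope classical_set_scope.
Local Open Scope ring_scope.

(* Euler's integral (Lebesgue, real-valued): it is the gamma function for
   0 < x; for x <= 0 the integral diverges, and [Rintegral] then returns 0
   instead of the analytic continuation. *)
Definition gamma (R : realType) (x : R) : R :=
  \int[@lebesgue_measure R]_(t in `]0, +oo[) (t `^ (x - 1) * expR (- t)).

(* The logarithmic derivative of [gamma]; since derivatives are local, neither
   [digamma] nor its derivatives at a point 0 < x depend on the values of
   [gamma] outside ]0, +oo[. *)
Definition digamma (R : realType) (x : R) : R :=
  ((@gamma R)^`())%classic x / gamma x.

(* Main.v *)
Require Import Defs.
From HB Require Import structures.
From mathcomp Require Import all_boot all_order all_algebra.
From mathcomp Require Import all_classical all_reals all_analysis.
From mathcomp Require Import measurable_realfun ring lra.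

(** Why the two inequalities hold.

Write [G_k(x)] for the integral of [(ln t)^k t^(x-1) e^(-t)] over the positive
half-line, the [k]-th derivative of the gamma function. Then [psi = G_1/G_0],
and [psi'] and [psi''] are the second and third cumulants of the random
variable [ln T], where [T] has the gamma distribution of parameter [x]
([derive1_digamma], [derive2_digamma]). Differentiating
[gamma (x + 1) = x gamma x] gives [psi''(x+1) = psi''(x) + 2/x^3].

The second inequality comes first. Put [u = 1/x] and [w = u/(1 - e^(-u))]. The
bound on [psi'] is [u w], and the bound on [psi''] is its derivative. A direct
computation shows that the latter equals
  [u^2 (1 + u/2 - w)^2 - q(x)]   with   [q(x) = 1/x^2 + 1/x^3 + 1/(4 x^4)],
and the square makes it at least [- q(x)] ([tetragamma_bound_square]). So for
[x >= 1/2] it suffices that [psi''(x) < - q(x)] ([log_cumulant3_lt_quartic]).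
There [q(x) - q(x+1) < 2/x^3], an inequality between rational functions, so
[psi'' + q] increases strictly along [x, x+1, x+2, ...]; it is negative
because it is bounded above by a quantity tending to 0.

That last fact needs an upper bound on [psi''] at infinity
([log_cumulant3_add1_le]). With [m = psi(x)] the mean of [ln T], the third
cumulant is the mean of [(ln T - m)^3], at most the mean of
[(T e^(-m) - 1)^3] since the cube is increasing. The latter involves only the
values of [gamma] at [x, ..., x+3], hence is an explicit function of [x] and
[x e^(-m)]; and [psi(x+1) >= ln x] makes it [O(1/x)].

For [x < 1/2], [psi''(x) = psi''(x+1) - 2/x^3 < - 2/x^3], and the bound is at
least [- 2/x^3] because it exceeds it by [u^2 (w - 2)(w - u)] with
[w >= u >= 2] ([tetragamma_bound_cube]).

The first inequality follows: the difference between [psi'] and its bound has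
a negative derivative, hence is strictly decreasing; as [psi' >= 0] (a variance)
and the bound is [O(1/x)], that difference is positive ([log_cumulant2_gt]). *)

Set Implicit Arguments.
Unset Strict Implicit.
Unset Printing Implicit Defensive.

Import Order.TTheory GRing.Theory Num.Theory.
Import numFieldNormedType.Exports.

Local Open Scope classical_set_scope.
Local Open Scope ring_scope.

(** * Integrals over the positive half-line *)

Lemma FTC2_pos (R : realType) (F f : R -> R) (a b : R) :
  (forall t : R, 0 < t -> is_derive t 1 F (f t)) ->
  (forall t : R, 0 < t -> {for t, continuous f}) ->
  0 < a -> a < b ->
  (\int[lebesgue_measure]_(t in `[a, b]) (f t)%:E = (F b - F a)%:E)%E.
Proof.
move=> dF cf a0 ab.
have cF t : 0 < t -> {for t, continuous F}.
  move=> t0; apply: differentiable_continuous; apply/derivable1_diffP.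
  by have /(_ t t0)[] := dF.
rewrite EFinB; apply: continuous_FTC2 => //.
- apply: continuous_in_subspaceT => t; rewrite inE/= in_itv/= => /andP[at_ _].
  by apply: cf; exact: lt_le_trans at_.
- split.
  + by move=> t; rewrite in_itv/= => /andP[at_ _]; have [] := dF t (lt_trans a0 at_).
  + by apply: cvg_at_right_filter; exact: cF.
  + by apply: cvg_at_left_filter; apply: cF; exact: lt_trans ab.
- move=> t; rewrite in_itv/= => /andP[at_ _].
  by rewrite derive1E; have /(_ t (lt_trans a0 at_))[] := dF.
Qed.

(** Compact intervals exhausting the open half-line; the offset 2 keeps each of
them nondegenerate, as the fundamental theorem of calculus requires. *)
Definition window {R : realType} (n : nat) : set R := `[n.+2%:R^-1, n.+2%:R].

Lemma window_lt {R : realType} n : n.+2%:R^-1 < n.+2%:R :> R.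
Proof.
by rewrite (@lt_trans _ _ 1)// ?invf_lt1 ?ltr1n ?ltr0n.
Qed.

Lemma windowS {R : realType} m n : (m <= n)%N -> @window R m `<=` window n.
Proof.
move=> mn t; rewrite /window/= !in_itv/= => /andP[mt tm]; apply/andP; split.
  by apply: le_trans mt; rewrite lef_pV2 ?posrE ?ltr0n// ler_nat.
by apply: (le_trans tm); rewrite ler_nat.
Qed.

Lemma window_pos {R : realType} n : @window R n `<=` `]0, +oo[.
Proof.
move=> t; rewrite /window/= !in_itv/= andbT => /andP[nt _].
by apply: lt_le_trans nt; rewrite invr_gt0 ltr0n.
Qed.

Lemma near_window {R : realType} (t : R) : 0 < t -> \forall n \near \oo, window n t.
Proof.
move=> t0; near=> n; rewrite /window/= in_itv/=; apply/andP; split.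
  rewrite invf_ple ?posrE ?ltr0n//.
  apply: (@le_trans _ _ n%:R); last by rewrite ler_nat -addn2 leq_addr.
  by near: n; exact: nbhs_infty_ger.
apply: (@le_trans _ _ n%:R); last by rewrite ler_nat -addn2 leq_addr.
by near: n; exact: nbhs_infty_ger.
Unshelve. all: by end_near. Qed.

Lemma integral_window {R : realType} (f : R -> R) n :
  (\int[lebesgue_measure]_(t in `]0%R, +oo[) ((f \_ (window n)) t)%:E =
   \int[lebesgue_measure]_(t in window n) (f t)%:E)%E.
Proof.
transitivity (\int[lebesgue_measure]_(t in (`]0%R, +oo[ `&` window n)) (f t)%:E)%E.
  by rewrite integral_mkcondr; apply: eq_integral => t _; rewrite restrict_EFin.
by rewrite setIidr//; exact: window_pos.
Qed.

Lemma patch_window_cvg {R : realType} (f : R -> R) (t : R) : 0 < t ->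
  ((f \_ (window n)) t)%:E @[n --> \oo] --> (f t)%:E.
Proof.
move=> t0; apply: (@cvg_near_cst _ _ _ _ _ _).
near=> n; rewrite patchE mem_set//; near: n; exact: near_window.
Unshelve. all: by end_near. Qed.

Lemma pos_measurable {R : realType} (f : R -> R) :
  (forall t : R, 0 < t -> {for t, continuous f}) -> measurable_fun `](0 : R), +oo[ f.
Proof.
move=> cf; apply: open_continuous_measurable_fun => // t.
by rewrite inE/= in_itv/= andbT; exact: cf.
Qed.

Lemma patch_window_measurable {R : realType} (f : R -> R) n :
  (forall t : R, 0 < t -> {for t, continuous f}) ->
  measurable_fun `](0 : R), +oo[ (fun t => ((f \_ (window n)) t)%:E).
Proof.
move=> cf; apply/measurable_EFinP.
apply/measurable_restrict => //; first exact: measurable_itv.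
apply: (measurable_funS _ _ (pos_measurable cf)); last exact: subIsetl.
exact: measurable_itv.
Qed.

(** Integrability on the whole half-line with a possible singularity at 0: the
integrals over the windows are differences of values of [F], hence at most
[M], and they converge monotonically. *)
Lemma integrable_bounded_primitive (R : realType) (F f : R -> R) (M : R) :
  (forall t : R, 0 < t -> is_derive t 1 F (f t)) ->
  (forall t : R, 0 < t -> {for t, continuous f}) ->
  (forall t : R, 0 < t -> 0 <= f t) ->
  (forall t : R, 0 < t -> 0 <= F t <= M) ->
  lebesgue_measure.-integrable `]0, +oo[ (EFin \o f).
Proof.
move=> dF cf f0 FM.
have mf : measurable_fun `](0 : R), +oo[ f by exact: pos_measurable.
have p0 n t : (0 <= ((f \_ (window n)) t)%:E)%E.
  rewrite lee_fin patchE; case: ifPn => // /set_mem/window_pos.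
  by rewrite /= in_itv/= andbT; exact: f0.
apply/integrableP; split; first exact/measurable_EFinP.
have -> : (\int[lebesgue_measure]_(t in `]0%R, +oo[) `|(EFin \o f) t| =
    \int[lebesgue_measure]_(t in `]0%R, +oo[)
      limn (fun n => ((f \_ (window n)) t)%:E))%E.
  apply: eq_integral => t; rewrite inE/= in_itv/= andbT => t0.
  rewrite (cvg_lim _ (@patch_window_cvg _ _ _ t0))//= ger0_norm//; exact: f0.
apply: (@le_lt_trans _ _ M%:E); last exact: ltry.
rewrite monotone_convergence//=; last 2 first.
- by move=> n; exact: patch_window_measurable.
- move=> t _ m n mn; rewrite lee_fin !patchE.
  case: ifPn => [/set_mem tm|_]; first by rewrite mem_set//; exact: windowS tm.
  by case: ifPn => // /set_mem/window_pos; rewrite /= in_itv/= andbT; exact: f0.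
have E n : (\int[lebesgue_measure]_(t in `]0%R, +oo[) ((f \_ (window n)) t)%:E <= M%:E)%E.
  rewrite integral_window (FTC2_pos dF cf) ?invr_gt0 ?ltr0n ?window_lt//.
  have n0 : 0 < n.+2%:R :> R by rewrite ltr0n.
  rewrite lee_fin; have /andP[_ ?] := FM _ n0.
  have /andP[? _] : 0 <= F n.+2%:R^-1 <= M by apply: FM; rewrite invr_gt0.
  lra.
apply: lime_le; last exact: nearW.
apply: ereal_nondecreasing_is_cvgn => m n mn; apply: ge0_le_integral => //.
- exact: patch_window_measurable.
- exact: patch_window_measurable.
- move=> t _; rewrite lee_fin !patchE.
  case: ifPn => [/set_mem tm|_]; first by rewrite mem_set//; exact: windowS tm.
  by case: ifPn => // /set_mem/window_pos; rewrite /= in_itv/= andbT; exact: f0.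
Qed.

(** The same exhaustion, by dominated convergence; this is the integration by
parts behind the functional equation of the gamma function. *)
Lemma Rintegral_derive_pos (R : realType) (F f : R -> R) :
  (forall t : R, 0 < t -> is_derive t 1 F (f t)) ->
  (forall t : R, 0 < t -> {for t, continuous f}) ->
  lebesgue_measure.-integrable `]0, +oo[ (EFin \o f) ->
  F n.+2%:R^-1 @[n --> \oo] --> (0 : R) ->
  F n.+2%:R @[n --> \oo] --> (0 : R) ->
  \int[lebesgue_measure]_(t in `]0, +oo[) f t = 0.
Proof.
move=> dF cf intf F0 Foo.
have mf : measurable_fun `](0 : R), +oo[ f by exact: pos_measurable.
have mfE : measurable_fun `](0 : R), +oo[ (EFin \o f) by exact/measurable_EFinP.
have [|||||_ _ h] := @dominated_convergence _ _ R (@lebesgue_measure R)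
  `](0 : R), +oo[ (measurable_itv _) (fun n t => ((f \_ (window n)) t)%:E)
  (EFin \o f) (fun t => `|(EFin \o f) t|)%E.
- by move=> n; exact: patch_window_measurable.
- exact: mfE.
- by apply: aeW => t; rewrite /= in_itv/= andbT; exact: patch_window_cvg.
- exact: integrable_abse.
- apply: aeW => t n _ /=; rewrite lee_fin patchE.
  by case: ifPn => // _; rewrite normr0.
have {}h : (F n.+2%:R - F n.+2%:R^-1)%:E @[n --> \oo] -->
  (\int[lebesgue_measure]_(t in `]0%R, +oo[) (f t)%:E)%E.
  rewrite (_ : (fun n => _) = (fun n =>
    \int[lebesgue_measure]_(t in `]0%R, +oo[) ((f \_ (window n)) t)%:E)%E)//.
  apply/funext => n.
  by rewrite integral_window (FTC2_pos dF cf) ?invr_gt0 ?ltr0n ?window_lt.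
have h0 : (F n.+2%:R - F n.+2%:R^-1)%:E @[n --> \oo] --> (0 : R)%:E.
  apply: cvg_EFin; first exact: nearW.
  by rewrite -(subr0 0); apply: cvgB.
by rewrite /Rintegral (cvg_unique _ h h0).
Qed.

(** * Derivatives of real functions given as lambda terms *)

Lemma is_derive1C {R : realType} (c x : R) : is_derive x 1 (fun=> c) 0.
Proof. exact: is_derive_cst. Qed.

Lemma is_derive1D {R : realType} (f g : R -> R) (x a b : R) :
  is_derive x 1 f a -> is_derive x 1 g b ->
  is_derive x 1 (fun t => f t + g t) (a + b).
Proof. exact: is_deriveD. Qed.

Lemma is_derive1B {R : realType} (f g : R -> R) (x a b : R) :
  is_derive x 1 f a -> is_derive x 1 g b ->
  is_derive x 1 (fun t => f t - g t) (a - b).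
Proof. exact: is_deriveB. Qed.

Lemma is_derive1M {R : realType} (f g : R -> R) (x a b : R) :
  is_derive x 1 f a -> is_derive x 1 g b ->
  is_derive x 1 (fun t => f t * g t) (f x * b + g x * a).
Proof. exact: is_deriveM. Qed.

Lemma is_derive1Z {R : realType} (k : R) (f : R -> R) (x a : R) :
  is_derive x 1 f a -> is_derive x 1 (fun t => k * f t) (k * a).
Proof. exact: is_deriveZ. Qed.

Lemma is_derive1V {R : realType} (f : R -> R) (x a : R) :
  is_derive x 1 f a -> f x != 0 ->
  is_derive x 1 (fun t => (f t)^-1) (- a / f x ^+ 2).
Proof.
move=> df fx0; apply: is_derive_eq (is_deriveV fx0 df) _.
by rewrite /GRing.scale/= mulrC mulrN mulNr.
Qed.

Lemma is_derive1Dn {R : realType} (f : R -> R) n (x a : R) :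
  is_derive x 1 f a ->
  is_derive x 1 (fun t => f t ^+ n) (n%:R * f x ^+ n.-1 * a).
Proof.
move=> df; have -> : (fun t => f t ^+ n) = f ^+ n by rewrite exprfctE.
exact: is_deriveX.
Qed.

Lemma is_derive1_chain {R : realType} (f g : R -> R) (x a b : R) :
  is_derive (g x) 1 f a -> is_derive x 1 g b ->
  is_derive x 1 (fun t => f (g t)) (a * b).
Proof. exact: is_derive1_comp. Qed.

Lemma is_derive1_continuous {R : realType} (f : R -> R) (x a : R) :
  is_derive x 1 f a -> {for x, continuous f}.
Proof.
by move=> [df _]; apply: differentiable_continuous; exact/derivable1_diffP.
Qed.

Lemma is_derive1_expRN {R : realType} (x : R) :
  is_derive x 1 (fun t => expR (- t)) (- expR (- x)).
Proof.
apply: is_derive_eq (is_derive1_chain (is_derive_expR _) (is_deriveNid _ _)) _.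
by rewrite mulrN1.
Qed.

(** * The gamma weight *)

Lemma powR_exp {R : realType} (t a : R) : 0 < t -> t `^ a = expR (a * ln t).
Proof. by move=> t0; rewrite /powR gt_eqF. Qed.

(** The maximum of [c ln t - t], attained at [t = c]. *)
Lemma powR_expRN_le {R : realType} (c t : R) : 0 < c -> 0 < t ->
  t `^ c * expR (- t) <= c `^ c.
Proof.
move=> c0 t0; rewrite !powR_exp// -expRD ler_expR lerBlDl -lerBlDr -mulrBr.
rewrite -ln_div ?posrE// mulrC -ler_pdivlMr//.
by apply/ltW/ln_sublinear; rewrite divr_gt0.
Qed.

Definition gamma_weight {R : realType} (x t : R) : R :=
  t `^ (x - 1) * expR (- t).

Lemma gamma_weight_gt0 {R : realType} (x t : R) : 0 < t -> 0 < gamma_weight x t.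
Proof. by move=> t0; rewrite mulr_gt0 ?powR_gt0 ?expR_gt0. Qed.

Lemma gamma_weight_shift {R : realType} (x t : R) : 0 < t ->
  gamma_weight (x + 1) t = t * gamma_weight x t.
Proof.
move=> t0; rewrite /gamma_weight mulrA; congr (_ * _).
have tp : t \in Num.pos by rewrite posrE.
rewrite !powR_exp// -[X in _ = X * _](lnK tp) -expRD.
by congr expR; ring.
Qed.

Lemma is_derive1_gamma_weight {R : realType} (x t : R) : 0 < t ->
  is_derive t 1 (gamma_weight x)
    (t `^ (x - 1) * - expR (- t) + expR (- t) * ((x - 1) * t `^ (x - 1 - 1))).
Proof.
move=> t0; have dp := is_derive1_powR (x - 1) t0.
exact: is_derive1M dp (is_derive1_expRN t).
Qed.

(** The ambient type matters: Lebesgue measure lives on [measurableTypeR R],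
whose display differs from the default one inferred for [R]. *)
Lemma measurable_pos {R : realType} :
  @measurable _ (measurableTypeR R) `]0, +oo[.
Proof. exact: measurable_itv. Qed.

(** The weight is dominated by a multiple of the derivative of the bounded
function [t^x / (1 + t^x)], which has the same singularity at 0 and decays
slower than any exponential at infinity. *)
Lemma integrable_gamma_weight (R : realType) (x : R) : 0 < x ->
  lebesgue_measure.-integrable `]0, +oo[ (EFin \o gamma_weight x).
Proof.
move=> x0.
pose F (t : R) := 1 - (1 + t `^ x)^-1.
pose f (t : R) := x * t `^ (x - 1) / (1 + t `^ x) ^+ 2.
have p0 (t : R) : 0 < 1 + t `^ x by rewrite ltr_wpDr ?powR_ge0.
have d1 (t : R) : 0 < t -> is_derive t 1 (fun t => 1 + t `^ x) (x * t `^ (x - 1)).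
  move=> t0; have := is_derive1D (is_derive1C 1 t) (is_derive1_powR x t0).
  by rewrite add0r.
have dF (t : R) : 0 < t -> is_derive t 1 F (f t).
  move=> t0.
  have := is_derive1B (is_derive1C 1 t) (is_derive1V (d1 _ t0) (lt0r_neq0 (p0 t))).
  by move/is_derive_eq; apply; rewrite /f sub0r mulNr opprK.
have cf (t : R) : 0 < t -> {for t, continuous f}.
  move=> t0; have n0 : (1 + t `^ x) ^+ 2 != 0 by rewrite expf_neq0// gt_eqF.
  exact: is_derive1_continuous (is_derive1M (is_derive1Z x (is_derive1_powR (x - 1) t0))
    (is_derive1V (is_derive1Dn 2 (d1 _ t0)) n0)).
have intf : lebesgue_measure.-integrable `]0, +oo[ (EFin \o f).
  apply: (integrable_bounded_primitive (M := 1) dF cf).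
    by move=> t t0; rewrite /f !(mulr_ge0, invr_ge0, powR_ge0, exprn_ge0)// ltW.
  move=> t t0; rewrite /F subr_ge0 lerBlDr lerDl invr_ge0 (ltW (p0 t)) andbT.
  by rewrite invf_le1// lerDl powR_ge0.
pose K := (2 * x) `^ (2 * x); pose C := (2 + 2 * K) / x.
have K0 : 0 <= K by exact: powR_ge0.
have intCf := integrableZl measurable_pos C intf.
apply: (le_integrable measurable_pos _ _ intCf).
- by apply/measurable_EFinP; apply: pos_measurable => t t0;
  exact: is_derive1_continuous (is_derive1_gamma_weight x t0).
- move=> t; rewrite /= in_itv/= andbT => t0; rewrite lee_fin.
  rewrite ger0_norm ?(ltW (gamma_weight_gt0 _ _))//.
  apply: le_trans (ler_norm _).
  rewrite /gamma_weight /C /f.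
  rewrite (_ : _ * (_ / _) = t `^ (x - 1) * ((2 + 2 * K) / (1 + t `^ x) ^+ 2)); last first.
    by field; rewrite !gt_eqF.
  rewrite ler_wpM2l ?powR_ge0// ler_pdivlMr ?exprn_gt0//.
  have T2 : (t `^ x) ^+ 2 * expR (- t) <= K.
    rewrite -powR_mulrn ?powR_ge0// -powRrM mulrC (mulrC x).
    by rewrite mulrC powR_expRN_le// mulr_gt0.
  have e1 : expR (- t) <= 1 by rewrite expR_le1 oppr_le0 ltW.
  have e0 : 0 <= expR (- t) by exact: expR_ge0.
  (* [(1 + s)^2 <= 2 + 2 s^2] for [s = t^x], multiplied by [e^(-t)]. *)
  have := mulr_ge0 e0 (sqr_ge0 (1 - t `^ x)).
  nra.
Qed.

(** One term of the exponential series. *)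
Lemma norm_pow_le_expR {R : realType} (k : nat) (b s : R) : 0 < b ->
  `|s| ^+ k <= k`!%:R / b ^+ k * expR (b * `|s|).
Proof.
move=> b0; have u0 : 0 <= b * `|s| by rewrite mulr_ge0// ltW.
rewrite mulrAC ler_pdivlMr ?exprn_gt0// -exprMn (mulrC `|s|).
case: k => [|k]; first by rewrite fact0 mul1r expr0 -[leLHS]expR0 ler_expR.
rewrite [leRHS]mulrC -ler_pdivrMr ?ltr0n ?fact_gt0//.
by apply: (le_trans _ (expR_ge1Dxn k u0)); rewrite lerDr.
Qed.

(** A bound uniform in [x], as differentiation under the integral requires: a
power of [|ln t|] costs at most a constant times [t^(u/2)] or [t^(-u/2)], which
leaves a weight of parameter at least [u/2] near 0 and at most [v + u/2] near
infinity. *)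
Lemma lnX_gamma_weight_le {R : realType} (k : nat) (u v x t : R) :
  0 < u -> u <= x <= v -> 0 < t ->
  `|ln t ^+ k * gamma_weight x t| <=
    k`!%:R / (u / 2) ^+ k * (gamma_weight (u / 2) t + gamma_weight (v + u / 2) t).
Proof.
move=> u0 /andP[ux xv] t0.
have b0 : 0 < u / 2 by rewrite divr_gt0.
rewrite normrM (gtr0_norm (gamma_weight_gt0 _ t0)) normrX.
apply: (le_trans (ler_wpM2r (ltW (gamma_weight_gt0 _ t0))
  (norm_pow_le_expR k (ln t) b0))).
rewrite -[leLHS]mulrA ler_wpM2l//.
  by rewrite divr_ge0// exprn_ge0// ltW.
rewrite /gamma_weight !powR_exp// mulrA -!mulrDl ler_wpM2r ?expR_ge0// -expRD.
have [s0|s0] := leP 0 (ln t).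
  apply: (@le_trans _ _ (expR ((v + u / 2 - 1) * ln t))); last first.
    by rewrite lerDr expR_ge0.
  by rewrite ler_expR ger0_norm//; nra.
apply: (@le_trans _ _ (expR ((u / 2 - 1) * ln t))); last first.
  by rewrite lerDl expR_ge0.
by rewrite ler_expR ltr0_norm//; nra.
Qed.

(** * Moments against the gamma weight *)

Definition gamma_moment {R : realType} (phi : R -> R) (x : R) : R :=
  \int[@lebesgue_measure R]_(t in `]0, +oo[) (phi t * gamma_weight x t).

Definition gamma_integrable {R : realType} (phi : R -> R) (x : R) : Prop :=
  (@lebesgue_measure R).-integrable `]0, +oo[
    (EFin \o (fun t => phi t * gamma_weight x t)).

Lemma gamma_integrable_lnX {R : realType} k (x : R) : 0 < x ->
  gamma_integrable (fun t => ln t ^+ k) x.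
Proof.
move=> x0; have b0 : 0 < x / 2 by rewrite divr_gt0.
set C := k`!%:R / (x / 2) ^+ k.
have intC := integrableZl measurable_pos C (integrableD measurable_pos
  (integrable_gamma_weight b0) (integrable_gamma_weight (addr_gt0 x0 b0))).
apply: (le_integrable measurable_pos _ _ intC).
- apply/measurable_EFinP; apply: pos_measurable => t t0.
  exact: is_derive1_continuous (is_derive1M
    (is_derive1Dn k (is_derive1_ln t0)) (is_derive1_gamma_weight x t0)).
- move=> t; rewrite /= in_itv/= andbT => t0; rewrite lee_fin.
  by apply: le_trans (ler_norm _); apply: lnX_gamma_weight_le; rewrite ?lexx.
Qed.

Lemma gamma_integrableX {R : realType} k (x : R) : 0 < x ->
  gamma_integrable (fun t => t ^+ k) x.
Proof.
elim: k x => [|k IH] x x0.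
  by have := gamma_integrable_lnX 0 x0; rewrite /gamma_integrable/=.
have := IH _ (addr_gt0 x0 ltr01); apply: (eq_integrable measurable_pos) => t.
rewrite inE/= in_itv/= andbT => t0 /=.
by rewrite gamma_weight_shift// exprSr mulrA.
Qed.

Lemma gamma_integrableD {R : realType} (f g : R -> R) x :
  gamma_integrable f x -> gamma_integrable g x ->
  gamma_integrable (fun t => f t + g t) x.
Proof.
move=> intf intg; have := integrableD measurable_pos intf intg.
by apply: (eq_integrable measurable_pos) => t _; rewrite /= mulrDl EFinD.
Qed.

Lemma gamma_integrableZ {R : realType} c (f : R -> R) x :
  gamma_integrable f x -> gamma_integrable (fun t => c * f t) x.
Proof.
move=> intf; have := integrableZl measurable_pos c intf.
by apply: (eq_integrable measurable_pos) => t _; rewrite /= -EFinM mulrA.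
Qed.

Lemma gamma_momentD {R : realType} (f g : R -> R) x :
  gamma_integrable f x -> gamma_integrable g x ->
  gamma_moment (fun t => f t + g t) x = gamma_moment f x + gamma_moment g x.
Proof.
move=> intf intg; rewrite /gamma_moment -(RintegralD measurable_pos intf intg).
by apply: eq_Rintegral => t _; rewrite mulrDl.
Qed.

Lemma gamma_momentZ {R : realType} c (f : R -> R) x :
  gamma_integrable f x ->
  gamma_moment (fun t => c * f t) x = c * gamma_moment f x.
Proof.
move=> intf; rewrite /gamma_moment -(RintegralZl c measurable_pos intf).
by apply: eq_Rintegral => t _; rewrite mulrA.
Qed.

Lemma le_gamma_moment {R : realType} (f g : R -> R) x :
  gamma_integrable f x -> gamma_integrable g x ->
  (forall t, 0 < t -> f t <= g t) -> gamma_moment f x <= gamma_moment g x.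
Proof.
move=> intf intg fg; apply: (le_Rintegral measurable_pos intf intg) => t.
rewrite /= in_itv/= andbT => t0.
by rewrite ler_wpM2r ?fg// ltW// gamma_weight_gt0.
Qed.

Lemma gamma_moment_shift {R : realType} (f g : R -> R) x :
  (forall t, 0 < t -> g t = t * f t) ->
  gamma_moment f (x + 1) = gamma_moment g x.
Proof.
move=> fg; apply: eq_Rintegral => t; rewrite inE/= in_itv/= andbT => t0.
by rewrite gamma_weight_shift// fg// mulrCA mulrA.
Qed.

Lemma gamma_weight_derive {R : realType} (x t : R) : 0 < t ->
  is_derive x 1 (gamma_weight^~ t) (ln t * gamma_weight x t).
Proof.
move=> t0.
have de := is_derive1M (is_derive1B (is_derive_id x 1) (is_derive1C 1 x))
  (is_derive1C (ln t) x).
have := is_derive1M (@is_derive1_chain _ expR _ _ _ _ (is_derive_expR _) de)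
  (is_derive1C (expR (- t)) x).
rewrite /gamma_weight (_ : (fun y => t `^ (y - 1) * expR (- t)) =
  (fun y => expR ((y - 1) * ln t) * expR (- t))); last first.
  by apply/funext => y; rewrite powR_exp.
by move/is_derive_eq; apply; rewrite powR_exp//; ring.
Qed.

(** Differentiation under the integral sign; for parameters between [x/2] and
[2 x] the differentiated integrand is dominated by [lnX_gamma_weight_le]. *)
Lemma is_derive_gamma_moment {R : realType} k (x : R) : 0 < x ->
  is_derive x 1 (gamma_moment (fun t => ln t ^+ k))
    (gamma_moment (fun t => ln t ^+ k.+1) x).
Proof.
move=> x0.
have u0 : 0 < x / 2 by rewrite divr_gt0.
have b0 : 0 < x / 2 / 2 by rewrite divr_gt0.
have v0 : 0 < 2 * x + x / 2 / 2 by rewrite addr_gt0// mulr_gt0.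
pose f (y t : R) := ln t ^+ k * gamma_weight y t.
pose C : R := k.+1`!%:R / (x / 2 / 2) ^+ k.+1.
pose G (t : R) := C * (gamma_weight (x / 2 / 2) t + gamma_weight (2 * x + x / 2 / 2) t).
have Ix : `]x / 2, 2 * x[%classic x by rewrite /= in_itv/=; apply/andP; split; lra.
have df (y t : R) : 0 < t -> is_derive y 1 (f^~ t) (ln t ^+ k.+1 * gamma_weight y t).
  move=> t0; have := is_derive1Z (ln t ^+ k) (gamma_weight_derive y t0).
  by move/is_derive_eq; apply; rewrite exprSr mulrA.
have intf (y : R) : `]x / 2, 2 * x[%classic y ->
    (@lebesgue_measure R).-integrable `]0, +oo[ (EFin \o f y).
  rewrite /= in_itv/= => /andP[xy _]; apply: gamma_integrable_lnX; lra.
have derf (y t : R) : `]x / 2, 2 * x[%classic y -> `]0, +oo[%classic t ->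
    derivable (f^~ t) y 1.
  by move=> _; rewrite /= in_itv/= andbT => t0; have [] := df y t t0.
have G0 (t : R) : 0 <= G t.
  by rewrite mulr_ge0 ?divr_ge0 ?exprn_ge0 ?addr_ge0 ?mulr_ge0 ?powR_ge0 ?expR_ge0// ltW.
have intG : (@lebesgue_measure R).-integrable `]0, +oo[ (EFin \o G).
  have := integrableZl measurable_pos C (integrableD measurable_pos
    (integrable_gamma_weight b0) (integrable_gamma_weight v0)).
  by apply: (eq_integrable measurable_pos) => t _.
have pE (y t : R) : 0 < t -> partial1of2 f y t = ln t ^+ k.+1 * gamma_weight y t.
  by move=> t0; rewrite partial1of2E; have [_ ->] := df y t t0.
have Gub (y t : R) : `]x / 2, 2 * x[%classic y -> `]0, +oo[%classic t ->
    `|partial1of2 f y t| <= G t.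
  rewrite /= !in_itv/= andbT => /andP[uy yv] t0; rewrite pE//.
  by apply: lnX_gamma_weight_le => //; rewrite (ltW uy) (ltW yv).
have D := derivable_under_integral measurable_pos Ix intf derf G0 intG Gub.
have E := differentiation_under_integral measurable_pos Ix intf derf G0 intG Gub.
apply: DeriveDef; first exact: D.
rewrite -derive1E E; apply: eq_Rintegral => t; rewrite inE/= in_itv/= andbT => t0.
exact: pE.
Qed.

(** * Derivatives of the gamma and digamma functions *)

(** The [k]-th derivative of the gamma function on the positive half-line. *)
Definition log_moment {R : realType} (k : nat) : R -> R :=
  gamma_moment (fun t => ln t ^+ k).

Lemma is_derive_log_moment {R : realType} k (x : R) : 0 < x ->
  is_derive x 1 (log_moment k) (log_moment k.+1 x).
Proof. exact: is_derive_gamma_moment. Qed.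

Lemma gamma_log_moment {R : realType} : @gamma R = log_moment 0.
Proof.
by apply/funext => x; apply: eq_Rintegral => t _; rewrite expr0 mul1r.
Qed.

(** On [[1, 2]] one has [t^(x-1) >= 1/t >= 1/2] and [e^(-t) >= e^(-2)]. *)
Lemma log_moment0_gt0 {R : realType} (x : R) : 0 < x -> 0 < log_moment 0 x.
Proof.
move=> x0.
have int0 := gamma_integrable_lnX 0 x0.
pose c : R := 2^-1 * expR (- 2).
have c0 : 0 < c by rewrite mulr_gt0 ?invr_gt0 ?expR_gt0.
suff h : (c%:E <= \int[lebesgue_measure]_(t in `]0%R, +oo[)
     (ln t ^+ 0 * gamma_weight x t)%:E)%E.
  apply: (lt_le_trans c0).
  by rewrite -lee_fin fineK//; exact: (integrable_fin_num measurable_pos int0).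
have sub : `[(1 : R), 2] `<=` `]0, +oo[.
  by move=> t; rewrite /= !in_itv/= andbT => /andP[t1 _]; apply: lt_le_trans t1.
have mw := measurable_int _ int0.
apply: (@le_trans _ _ (\int[lebesgue_measure]_(t in `[1%R, 2%R])
    (ln t ^+ 0 * gamma_weight x t)%:E)%E).
  have -> : c%:E = (\int[lebesgue_measure]_(t in `[1%R, 2%R]) c%:E)%E.
    rewrite integral_cst; last exact: measurable_itv.
    rewrite /= lebesgue_measure_itv/=.
    by rewrite lte_fin ltr1n -EFinB -EFinM (_ : 2 - 1 = 1 :> R) ?mulr1//; ring.
  apply: ge0_le_integral.
  - exact: measurable_itv.
  - by move=> t _; rewrite lee_fin ltW.
  - exact: measurable_cst.
  - by apply: measurable_funS mw => //; exact: measurable_pos.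
  - move=> t; rewrite /= in_itv/= => /andP[t1 t2].
    have t0 : 0 < t by exact: lt_le_trans t1.
    rewrite lee_fin expr0 mul1r ler_pM ?invr_ge0 ?expR_ge0//.
    + rewrite powR_exp// -(@lnK _ 2^-1) ?posrE ?invr_gt0// ler_expR lnV ?posrE//.
      have l0 : 0 <= ln t by exact: ln_ge0.
      have l2 : ln t <= ln 2 by rewrite ler_ln ?posrE.
      nra.
    + by rewrite ler_expR lerN2.
apply: (@ge0_subset_integral _ _ R (@lebesgue_measure R) _ _ (measurable_itv _)
  measurable_pos _ mw _ sub).
move=> t; rewrite /= in_itv/= andbT => t0.
by rewrite lee_fin expr0 mul1r ltW// gamma_weight_gt0.
Qed.

Lemma cvg_inv_nat2 {R : realType} : (n.+2%:R^-1 : R) @[n --> \oo] --> (0 : R).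
Proof.
have := @cvg_harmonic R; rewrite -cvg_shiftS; exact.
Qed.

(** The functional equation: [t^x e^(-t)] vanishes at both ends, so its
derivative [x t^(x-1) e^(-t) - t^x e^(-t)] has integral 0. *)
Lemma log_moment0_add1 {R : realType} (x : R) : 0 < x ->
  log_moment 0 (x + 1) = x * log_moment 0 x.
Proof.
move=> x0.
have x10 : 0 < x + 1 by rewrite addr_gt0.
pose F (t : R) := t `^ x * expR (- t).
pose f (t : R) := x * gamma_weight x t - gamma_weight (x + 1) t.
have dF (t : R) : 0 < t -> is_derive t 1 F (f t).
  move=> t0; have := is_derive1M (is_derive1_powR x t0) (is_derive1_expRN t).
  move/is_derive_eq; apply; rewrite /f /gamma_weight addrK; ring.
have cf (t : R) : 0 < t -> {for t, continuous f}.
  move=> t0; exact: is_derive1_continuous (is_derive1B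
    (is_derive1Z x (is_derive1_gamma_weight x t0)) (is_derive1_gamma_weight (x + 1) t0)).
have intf : (@lebesgue_measure R).-integrable `]0, +oo[ (EFin \o f).
  have := integrableB measurable_pos
    (integrableZl measurable_pos x (integrable_gamma_weight x0))
    (integrable_gamma_weight x10).
  by apply: (eq_integrable measurable_pos) => t _; rewrite /= -EFinM -EFinB.
have F0 (t : R) : 0 < t -> 0 <= F t.
  by move=> t0; rewrite mulr_ge0 ?powR_ge0 ?expR_ge0.
have F_0 : F n.+2%:R^-1 @[n --> \oo] --> (0 : R).
  apply: (@squeeze_cvgr _ _ _ _ (cst 0) (fun n => n.+2%:R^-1 `^ x)).
  - apply: nearW => n; have n0 : 0 < n.+2%:R^-1 :> R by rewrite invr_gt0.
    rewrite F0//= ler_piMr ?powR_ge0// expR_le1 oppr_le0 ltW//.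
  - exact: cvg_cst.
  - have /cvg_at_rightP := powR_cvg0 x0; apply; split; last exact: cvg_inv_nat2.
    by move=> n; rewrite invr_gt0.
have F_oo : F n.+2%:R @[n --> \oo] --> (0 : R).
  apply: (@squeeze_cvgr _ _ _ _ (cst 0) (fun n => (x + 1) `^ (x + 1) * n.+2%:R^-1)).
  - apply: nearW => n; have n0 : 0 < n.+2%:R :> R by [].
    rewrite F0//= ler_pdivlMr//; apply: le_trans (powR_expRN_le x10 n0).
    have := gamma_weight_shift (x + 1) n0; rewrite /gamma_weight !addrK => ->.
    by rewrite mulrC.
  - exact: cvg_cst.
  - rewrite -[X in _ --> X](mulr0 ((x + 1) `^ (x + 1))).
    by apply: cvgMr; exact: cvg_inv_nat2.
have := Rintegral_derive_pos dF cf intf F_0 F_oo.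
rewrite RintegralB; last 3 first.
- exact: measurable_pos.
- have := integrableZl measurable_pos x (integrable_gamma_weight x0).
  by apply: (eq_integrable measurable_pos).
- exact: integrable_gamma_weight.
rewrite (RintegralZl _ measurable_pos (integrable_gamma_weight x0)) => /eqP.
rewrite subr_eq0 => /eqP h; rewrite /log_moment /gamma_moment.
under eq_Rintegral do rewrite expr0 mul1r.
under [in RHS]eq_Rintegral do rewrite expr0 mul1r.
by rewrite h.
Qed.

(** The Leibniz rule for the [k]-th derivative of [x gamma x]; at [k = 0] the
term in [k.-1] has coefficient 0. *)
Lemma log_moment_add1 {R : realType} k (x : R) : 0 < x ->
  log_moment k (x + 1) = k%:R * log_moment k.-1 x + x * log_moment k x.
Proof.
elim: k x => [|k IH] x x0; first by rewrite mul0r add0r log_moment0_add1.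
have x10 : 0 < x + 1 by rewrite addr_gt0.
have dl := @is_derive1_chain _ (log_moment k) (fun y => y + 1) _ _ _
  (is_derive_log_moment k x10)
  (is_derive1D (is_derive_id x 1) (is_derive1C 1 x)).
have dr : is_derive x 1 (fun y => k%:R * log_moment k.-1 y + y * log_moment k y)
    (k%:R * log_moment k x + (x * log_moment k.+1 x + log_moment k x * 1)).
  apply: is_derive1D; last first.
    exact: is_derive1M (is_derive_id x 1) (is_derive_log_moment k x0).
  case: k {IH dl} => [|k].
    rewrite mul0r (_ : (fun _ => _) = fun=> 0); first exact: is_derive1C.
    by apply/funext => y; rewrite mul0r.
  exact: is_derive1Z (is_derive_log_moment k x0).
have E : \near x, log_moment k (x + 1) = k%:R * log_moment k.-1 x + x * log_moment k x.
  by near=> y; apply: IH; near: y; exact: lt_nbhsr.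
have [_ dE] := near_eq_is_derive E dl.
have [_] := dr; rewrite dE addr0 mulr1 => ->.
by rewrite -natr1; ring.
Unshelve. all: by end_near. Qed.

(** The variance of [ln T], where [T] has density proportional to
[t^(x-1) e^(-t)]. *)
Definition log_cumulant2 {R : realType} (x : R) : R :=
  log_moment 2 x / log_moment 0 x - (log_moment 1 x / log_moment 0 x) ^+ 2.

(** The third central moment of the same [ln T]. *)
Definition log_cumulant3 {R : realType} (x : R) : R :=
  log_moment 3 x / log_moment 0 x
  - 3 * (log_moment 2 x / log_moment 0 x) * (log_moment 1 x / log_moment 0 x)
  + 2 * (log_moment 1 x / log_moment 0 x) ^+ 3.

Lemma digammaE {R : realType} (x : R) : 0 < x ->
  digamma x = log_moment 1 x / log_moment 0 x.
Proof.
move=> x0; rewrite /digamma gamma_log_moment derive1E.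
by have [_ ->] := is_derive_log_moment 0 x0.
Qed.

Lemma is_derive_log_ratio {R : realType} k (x : R) : 0 < x ->
  is_derive x 1 (fun y => log_moment k y / log_moment 0 y)
    (log_moment k.+1 x / log_moment 0 x
     - (log_moment k x / log_moment 0 x) * (log_moment 1 x / log_moment 0 x)).
Proof.
move=> x0; have n0 := lt0r_neq0 (log_moment0_gt0 x0).
have := is_derive1M (is_derive_log_moment k x0)
  (is_derive1V (is_derive_log_moment 0 x0) n0).
by move/is_derive_eq; apply; field.
Qed.

Lemma is_derive_digamma {R : realType} (x : R) : 0 < x ->
  is_derive x 1 (@digamma R) (log_cumulant2 x).
Proof.
move=> x0; apply: near_eq_is_derive (is_derive_log_ratio 1 x0).
by near=> y; rewrite digammaE//; near: y; exact: lt_nbhsr.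
Unshelve. all: by end_near. Qed.

Lemma derive1_digamma {R : realType} (x : R) : 0 < x ->
  (@digamma R)^`()%classic x = log_cumulant2 x.
Proof. by move=> x0; rewrite derive1E; have [_ ->] := is_derive_digamma x0. Qed.

Lemma is_derive_log_cumulant2 {R : realType} (x : R) : 0 < x ->
  is_derive x 1 (@log_cumulant2 R) (log_cumulant3 x).
Proof.
move=> x0; have := is_derive1B (is_derive_log_ratio 2 x0)
  (is_derive1Dn 2 (is_derive_log_ratio 1 x0)).
by move/is_derive_eq; apply; rewrite /log_cumulant3 /=; ring.
Qed.

Lemma derive2_digamma {R : realType} (x : R) : 0 < x ->
  (@digamma R)^`(2)%classic x = log_cumulant3 x.
Proof.
move=> x0; rewrite derive1nS derive1E.
have [_ <-] := is_derive_log_cumulant2 x0.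
apply: near_eq_derive.
by near=> y; rewrite derive1n1 derive1_digamma//; near: y; exact: lt_nbhsr.
Unshelve. all: by end_near. Qed.

Lemma log_cumulant3_add1 {R : realType} (x : R) : 0 < x ->
  log_cumulant3 (x + 1) = log_cumulant3 x + 2 / x ^+ 3.
Proof.
move=> x0; have n0 := lt0r_neq0 (log_moment0_gt0 x0).
rewrite /log_cumulant3 !log_moment_add1//=.
by field; rewrite n0 gt_eqF.
Qed.

Lemma gamma_moment_lin4 {R : realType} (f : nat -> R -> R) (a b c d x : R) :
  (forall k, gamma_integrable (f k) x) ->
  let h t := a * f 0%N t + b * f 1%N t + c * f 2%N t + d * f 3%N t in
  gamma_integrable h x /\
  gamma_moment h x = a * gamma_moment (f 0%N) x + b * gamma_moment (f 1%N) x
    + c * gamma_moment (f 2%N) x + d * gamma_moment (f 3%N) x.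
Proof.
move=> intf h; have I k e := gamma_integrableZ e (intf k).
have I1 := gamma_integrableD (I 0%N a) (I 1%N b).
have I2 := gamma_integrableD I1 (I 2%N c).
split; first exact: gamma_integrableD I2 (I 3%N d).
by rewrite /h !gamma_momentD// !gamma_momentZ.
Qed.

(** * Bounds on the cumulants of the logarithm *)

Lemma gamma_moment_ge0 {R : realType} (f : R -> R) x :
  (forall t, 0 < t -> 0 <= f t) -> 0 <= gamma_moment f x.
Proof.
move=> f0; apply: Rintegral_ge0 => t; rewrite /= in_itv/= andbT => t0.
by rewrite mulr_ge0 ?f0// ltW// gamma_weight_gt0.
Qed.

(** The integral of [(ln t - m)^2] for [m] the mean of [ln T]. *)
Lemma log_cumulant2_ge0 {R : realType} (x : R) : 0 < x -> 0 <= log_cumulant2 x.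
Proof.
move=> x0; have n0 := log_moment0_gt0 x0.
set m := log_moment 1 x / log_moment 0 x.
have [_ E] := gamma_moment_lin4 (m ^+ 2) (- 2 * m) 1 0
  (fun k => gamma_integrable_lnX k x0).
have : 0 <= m ^+ 2 * log_moment 0 x + - 2 * m * log_moment 1 x + 1 * log_moment 2 x
         + 0 * log_moment 3 x.
  rewrite /log_moment -E; apply: gamma_moment_ge0 => t t0.
  rewrite (_ : _ + _ = (ln t - m) ^+ 2) ?sqr_ge0//; ring.
rewrite (_ : _ + _ = log_moment 0 x * log_cumulant2 x) ?pmulr_rge0//.
by rewrite /m /log_cumulant2; field; rewrite gt_eqF.
Qed.

Lemma gamma_momentX0 {R : realType} (x : R) :
  gamma_moment (fun t => t ^+ 0) x = log_moment 0 x.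
Proof. by []. Qed.

Lemma gamma_momentXS {R : realType} k (x : R) :
  gamma_moment (fun t => t ^+ k.+1) x = gamma_moment (fun t => t ^+ k) (x + 1).
Proof.
by apply/esym; apply: gamma_moment_shift => t _; rewrite exprS.
Qed.

Lemma ln_le_subr1 {R : realType} (r : R) : 0 < r -> ln r <= r - 1.
Proof.
move=> r0; rewrite -[X in ln X](subrKC 1); apply: le_ln1Dx; lra.
Qed.

(** Integrate [ln t >= ln x + 1 - x/t], the tangent bound at [t = x], against
the weight of parameter [x+1]: the last two terms cancel since
[gamma (x + 1) = x gamma x]. *)
Lemma digamma_add1_ge_ln {R : realType} (x : R) : 0 < x ->
  ln x <= log_moment 1 (x + 1) / log_moment 0 (x + 1).
Proof.
move=> x0; have x10 : 0 < x + 1 by rewrite addr_gt0.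
rewrite ler_pdivlMr ?log_moment0_gt0//.
have [intf E] := gamma_moment_lin4 (- x) (ln x + 1) 0 0
  (fun k => gamma_integrableX k x0).
have intg : gamma_integrable (fun t => t * ln t ^+ 1) x.
  have := gamma_integrable_lnX 1 x10; apply: (eq_integrable measurable_pos) => t.
  rewrite inE/= in_itv/= andbT => t0.
  by rewrite gamma_weight_shift// mulrCA mulrA.
have := le_gamma_moment intf intg.
have <- : log_moment 1 (x + 1) = gamma_moment (fun t => t * ln t ^+ 1) x.
  exact: gamma_moment_shift.
rewrite E; cbv beta; rewrite gamma_momentXS !gamma_momentX0.
rewrite log_moment0_add1// => h.
rewrite (le_trans _ (h _))//; first by rewrite !mul0r !addr0; lra.
move=> t t0; rewrite expr0 !expr1 !mul0r !addr0 mulr1.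
have : ln (x / t) <= x / t - 1 by apply: ln_le_subr1; rewrite divr_gt0.
rewrite ln_div ?posrE// => l.
have := ler_wpM2l (ltW t0) l.
by rewrite mulrBr mulrBr mulrCA divff ?gt_eqF//; lra.
Qed.

Lemma ler_cube {R : realDomainType} (a b : R) : a <= b -> a ^+ 3 <= b ^+ 3.
Proof.
move=> ab; have := mulr_ge0 (_ : 0 <= b - a) (_ : 0 <= a ^+ 2 + b ^+ 2 + (a + b) ^+ 2).
rewrite subr_ge0 !addr_ge0 ?sqr_ge0// => /(_ ab isT).
by rewrite (_ : _ * _ = 2 * (b ^+ 3 - a ^+ 3)); [lra|ring].
Qed.

(** For [m] the mean of [ln T] and [e = e^(-m)], [ln t - m = ln (t e) <= t e - 1],
and the cube is increasing; the mean of [(T e - 1)^3] is computed from the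
functional equation. *)
Lemma log_cumulant3_le {R : realType} (x e : R) : 0 < x ->
  e = expR (- (log_moment 1 x / log_moment 0 x)) ->
  log_cumulant3 x <=
    x * (x + 1) * (x + 2) * e ^+ 3 - 3 * (x * (x + 1)) * e ^+ 2 + 3 * x * e - 1.
Proof.
move=> x0 eE; have n0 := log_moment0_gt0 x0.
have x10 : 0 < x + 1 by rewrite addr_gt0.
have x20 : 0 < x + 1 + 1 by rewrite addr_gt0.
set m := log_moment 1 x / log_moment 0 x in eE.
have [intf Ef] := gamma_moment_lin4 (- m ^+ 3) (3 * m ^+ 2) (- 3 * m) 1
  (fun k => gamma_integrable_lnX k x0).
have [intg Eg] := gamma_moment_lin4 (-1) (3 * e) (- 3 * e ^+ 2) (e ^+ 3)
  (fun k => gamma_integrableX k x0).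
have := le_gamma_moment intf intg; rewrite Ef Eg; cbv beta.
rewrite !gamma_momentXS !gamma_momentX0 !log_moment0_add1//.
rewrite -/(log_moment 0 x) -/(log_moment 1 x) -/(log_moment 2 x) -/(log_moment 3 x).
move=> h.
rewrite -(ler_pM2l n0).
rewrite (_ : _ * log_cumulant3 x = - m ^+ 3 * log_moment 0 x + 3 * m ^+ 2 * log_moment 1 x
   + - 3 * m * log_moment 2 x + 1 * log_moment 3 x); last first.
  by rewrite /m /log_cumulant3; field; rewrite gt_eqF.
apply: (le_trans (h _)); last first.
  by rewrite le_eqVlt; apply/orP; left; apply/eqP; ring.
move=> t t0.
rewrite (_ : _ + _ = (ln t - m) ^+ 3); last by ring.
rewrite (_ : _ + _ * t ^+ 3 = (t * e - 1) ^+ 3); last by ring.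
apply: ler_cube; have e0 : 0 < e by rewrite eE expR_gt0.
have := ln_le_subr1 (mulr_gt0 t0 e0).
by rewrite lnM ?posrE// eE expRK.
Qed.

(** With [X = x + 1] and [y = X e], the bound of [log_cumulant3_le] is
[(y-1)^3 + 3 y^2 (y-1)/X + 2 y^3/X^2], where [y <= 1 + 1/x] because
[psi(X) >= ln x]. The constant 29 is a crude sum of [1 + 12 + 16]. *)
Lemma log_cumulant3_add1_le {R : realType} (x : R) : 1 <= x ->
  log_cumulant3 (x + 1) <= 29 / x.
Proof.
move=> x1; have x0 : 0 < x by lra.
have x10 : 0 < x + 1 by lra.
have := log_cumulant3_le x10 erefl; set e := expR _ => h.
have e0 : 0 < e by exact: expR_gt0.
pose z := x^-1.
have z0 : 0 < z by rewrite invr_gt0.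
have z1 : z <= 1 by rewrite invf_le1.
have ez : e <= z.
  by rewrite -[z]lnK ?posrE// ler_expR lnV ?posrE// lerN2 digamma_add1_ge_ln.
pose y := (x + 1) * e; pose c := (x + 1)^-1.
have c0 : 0 < c by rewrite invr_gt0.
have cz : c <= z by rewrite lef_pV2 ?posrE//; lra.
have y0 : 0 < y by rewrite mulr_gt0.
have yz : y <= 1 + z.
  rewrite (_ : 1 + z = (x + 1) * z) ?ler_pM2l// /z; field; lra.
apply: (le_trans h).
rewrite (_ : _ - 1 = (y - 1) ^+ 3 + 3 * c * (y ^+ 2 * (y - 1))
  + 2 * c ^+ 2 * y ^+ 3); last first.
  by rewrite /y /c; field; lra.
have B1 : (y - 1) ^+ 3 <= z.
  apply: (@le_trans _ _ (z ^+ 3)); first by apply: ler_cube; lra.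
  by rewrite exprS ler_piMr ?exprn_ile1// ltW.
have B2 : y ^+ 2 * (y - 1) <= 4 * z.
  apply: (@le_trans _ _ (y ^+ 2 * z)); first by rewrite ler_wpM2l ?sqr_ge0//; lra.
  by rewrite ler_wpM2r ?(ltW z0)//; nra.
have B2' : c * (y ^+ 2 * (y - 1)) <= 4 * z.
  apply: (le_trans (ler_wpM2l (ltW c0) B2)); nra.
have B3 : y ^+ 3 <= 8.
  by rewrite (_ : 8 = 2 ^+ 3); [apply: ler_cube; lra|ring].
have B3' : c ^+ 2 * y ^+ 3 <= 8 * z.
  apply: (@le_trans _ _ (c ^+ 2 * 8)); first by rewrite ler_wpM2l ?sqr_ge0.
  by rewrite mulrC ler_wpM2l//; nra.
rewrite -/z; lra.
Qed.

(** * Comparison with the elementary bounds *)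

Lemma exists_nat_ltr_div {R : realType} (K e : R) : 0 < e ->
  exists n : nat, K / n.+1%:R < e.
Proof.
move=> e0; have [n nP] : exists n : nat, `|K| / e < n%:R.
  by exists (Num.bound (`|K| / e)); apply: archi_boundP; rewrite divr_ge0// ltW.
exists n; rewrite ltr_pdivrMr// -ltr_pdivrMl// mulrC.
apply: (@le_lt_trans _ _ (`|K| / e)).
  by rewrite ler_wpM2r ?ler_norm// invr_ge0 ltW.
by apply: (lt_trans nP); rewrite ltr_nat.
Qed.

(** This is [(1/x + 1/(2 x^2))^2]; it is a lower bound of [- psi''] for
[x >= 1/2], and completes the square in the elementary bound. *)
Definition quartic {R : realType} (x : R) : R :=
  1 / x ^+ 2 + 1 / x ^+ 3 + 1 / (4 * x ^+ 4).

(** After clearing denominators this is [4 x^3 + 6 x^2 - 1 > 0]. It fails for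
small [x], where [1/(4 x^4)] exceeds [2/x^3]; hence the separate treatment of
[x < 1/2] in [log_cumulant3_lt]. *)
Lemma quartic_sub_lt {R : realType} (x : R) : 2^-1 <= x ->
  quartic x - quartic (x + 1) < 2 / x ^+ 3.
Proof.
move=> xh; have x0 : 0 < x by lra.
have x10 : 0 < x + 1 by lra.
rewrite -subr_gt0.
rewrite (_ : _ - _ = (4 * x ^+ 3 + 6 * x ^+ 2 - 1) / (4 * x ^+ 4 * (x + 1) ^+ 4)); last first.
  by rewrite /quartic; field; rewrite !gt_eqF.
rewrite divr_gt0 ?mulr_gt0 ?exprn_gt0//.
have : 0 <= (x - 2^-1) * (x + 2^-1) by rewrite mulr_ge0; lra.
have : 0 < x ^+ 3 by rewrite exprn_gt0.
lra.
Qed.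

Lemma quartic_le {R : realType} (x : R) : 1 <= x -> quartic x <= 3 / x.
Proof.
move=> x1; have x0 : 0 < x by lra.
rewrite -subr_ge0 /quartic.
rewrite (_ : _ - _ = (12 * x ^+ 3 - 4 * x ^+ 2 - 4 * x - 1) / (4 * x ^+ 4)); last first.
  by field; rewrite gt_eqF.
rewrite divr_ge0 ?mulr_ge0 ?exprn_ge0 ?(ltW x0)//.
have x2 : x <= x ^+ 2 by rewrite expr2 ler_peMl// ltW.
have x3 : x ^+ 2 <= x ^+ 3 by rewrite exprS ler_peMl// sqr_ge0.
lra.
Qed.

(** [psi'' + quartic] increases strictly along [x, x+1, ...] by
[quartic_sub_lt], and is eventually below any positive number. *)
Lemma log_cumulant3_lt_quartic {R : realType} (x : R) : 2^-1 <= x ->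
  log_cumulant3 x < - quartic x.
Proof.
move=> xh; pose D (y : R) := log_cumulant3 y + quartic y.
suff : D x < 0 by rewrite /D; lra.
have step (y : R) : 2^-1 <= y -> D y < D (y + 1).
  move=> yh; rewrite /D log_cumulant3_add1; last by lra.
  have := quartic_sub_lt yh; lra.
have steps n : D (x + 1) <= D (x + 1 + n%:R).
  elim: n => [|n IH]; first by rewrite addr0.
  have n0 : 0 <= n%:R :> R by [].
  rewrite -natr1 addrA (le_trans IH)// ltW//; apply: step; lra.
apply: (lt_le_trans (step x xh)); rewrite leNgt; apply/negP => D0.
(* 32 is 29 from [log_cumulant3_add1_le] plus 3 from [quartic_le]. *)
have [n nP] := exists_nat_ltr_div 32 D0.
have := steps n.+1; apply/negP; rewrite -ltNge; apply: le_lt_trans nP.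
have n1 : 1 <= n.+1%:R :> R by rewrite ler1n.
set N := n.+1%:R in n1 *.
have xN1 : 1 <= x + N by lra.
rewrite /D (addrAC x).
have B1 := log_cumulant3_add1_le xN1.
have B2 : quartic (x + N + 1) <= 3 / (x + N + 1) by apply: quartic_le; lra.
have c1 : (x + N)^-1 <= N^-1 by rewrite lef_pV2 ?posrE; lra.
have c2 : (x + N + 1)^-1 <= N^-1 by rewrite lef_pV2 ?posrE; lra.
move: B1 B2 c1 c2; set a := _^-1; set b := _^-1; set c := _^-1 => B1 B2 c1 c2; lra.
Qed.

Definition trigamma_bound {R : realType} (x : R) : R :=
  expR (1 / x) / ((expR (1 / x) - 1) * x ^+ 2).

Definition tetragamma_bound {R : realType} (x : R) : R :=
  expR (1 / x) * (1 - 2 * x * (expR (1 / x) - 1)) /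
      ((expR (1 / x) - 1) ^+ 2 * x ^+ 4).

Lemma expR_inv_subr1 {R : realType} (x : R) : 0 < x -> 1 / x <= expR (1 / x) - 1.
Proof. by move=> x0; have := expR_ge1Dx (1 / x); lra. Qed.

Lemma expR_inv_subr1_gt0 {R : realType} (x : R) : 0 < x -> 0 < expR (1 / x) - 1.
Proof.
by move=> x0; apply: lt_le_trans (expR_inv_subr1 x0); rewrite divr_gt0.
Qed.

(** The quotient rule for [trigamma_bound], with [E] for [e^(1/x)]. *)
Lemma trigamma_bound_derivativeE {F : numFieldType} (E x : F) :
  E - 1 != 0 -> x != 0 ->
  E * (- ((E - 1) * (2 * x) + x ^+ 2 * (E * (- 1 / x ^+ 2))) /
       ((E - 1) * x ^+ 2) ^+ 2) +
  ((E - 1) * x ^+ 2)^-1 * (E * (- 1 / x ^+ 2)) =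
  E * (1 - 2 * x * (E - 1)) / ((E - 1) ^+ 2 * x ^+ 4).
Proof. by move=> E0 x0; field; rewrite x0 E0. Qed.

Lemma is_derive_trigamma_bound {R : realType} (x : R) : 0 < x ->
  is_derive x 1 (@trigamma_bound R) (tetragamma_bound x).
Proof.
move=> x0; have xn0 := lt0r_neq0 x0.
have E0 := lt0r_neq0 (expR_inv_subr1_gt0 x0).
have di := is_derive1M (is_derive1C 1 x) (is_derive1V (is_derive_id x 1) xn0).
have de := @is_derive1_chain _ expR _ _ _ _ (is_derive_expR _) di.
have dd := is_derive1M (is_derive1B de (is_derive1C 1 x))
  (is_derive1Dn 2 (is_derive_id x 1)).
have dn : (expR (1 / x) - 1) * x ^+ 2 != 0 by rewrite mulf_neq0 ?expf_neq0.
have := is_derive1M de (is_derive1V dd dn).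
move/is_derive_eq; apply.
rewrite /tetragamma_bound; move: (expR (1 / x)) E0 {dn dd de di} => E E0.
rewrite !mulr0 !addr0 subr0 !mul1r !mulr1.
exact: trigamma_bound_derivativeE.
Qed.

(** With [E = e^(1/x)], the quotient [E / ((E - 1) x)] is
[w = (1/x) / (1 - e^(-1/x))]; the polynomial in [w] is a perfect square up to
[quartic]. *)
Lemma tetragamma_bound_square {F : realFieldType} (E x : F) :
  0 < E - 1 -> 0 < x ->
  E * (1 - 2 * x * (E - 1)) / ((E - 1) ^+ 2 * x ^+ 4) =
  1 / x ^+ 2 * (1 + 1 / (2 * x) - E / ((E - 1) * x)) ^+ 2
  - (1 / x ^+ 2 + 1 / x ^+ 3 + 1 / (4 * x ^+ 4)).
Proof. by move=> E0 x0; field; rewrite !gt_eqF. Qed.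

(** The same expression compared with [- 2/x^3], which is the sharp order as
[x] tends to 0; the remainder is nonnegative for [x <= 1/2]. *)
Lemma tetragamma_bound_cube {F : realFieldType} (E x : F) :
  0 < E - 1 -> 0 < x ->
  E * (1 - 2 * x * (E - 1)) / ((E - 1) ^+ 2 * x ^+ 4) =
  (E * (1 - 2 * x) + 2 * x) / ((E - 1) ^+ 2 * x ^+ 4) - 2 / x ^+ 3.
Proof. by move=> E0 x0; field; rewrite !gt_eqF. Qed.

Lemma oppr_quartic_le_tetragamma_bound {R : realType} (x : R) : 0 < x ->
  - quartic x <= tetragamma_bound x.
Proof.
move=> x0; have E0 := expR_inv_subr1_gt0 x0.
rewrite /tetragamma_bound tetragamma_bound_square// lerDr.
by rewrite mulr_ge0 ?sqr_ge0// divr_ge0// sqr_ge0.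
Qed.

Lemma oppr_cube_le_tetragamma_bound {R : realType} (x : R) :
  0 < x -> x <= 2^-1 -> - (2 / x ^+ 3) <= tetragamma_bound x.
Proof.
move=> x0 xh; have E0 := expR_inv_subr1_gt0 x0.
rewrite /tetragamma_bound tetragamma_bound_cube// lerDr.
rewrite divr_ge0 ?mulr_ge0 ?exprn_ge0 ?(ltW x0) ?(ltW E0)//.
by rewrite addr_ge0 ?mulr_ge0 ?expR_ge0//; lra.
Qed.

(** For small [x] the inequality is pulled back from [x + 1] by the recurrence,
at the cost of the term [- 2/x^3]. *)
Lemma log_cumulant3_lt {R : realType} (x : R) : 0 < x ->
  log_cumulant3 x < tetragamma_bound x.
Proof.
move=> x0; have [xh|xh] := leP 2^-1 x.
  exact: lt_le_trans (log_cumulant3_lt_quartic xh) (oppr_quartic_le_tetragamma_bound x0).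
apply: lt_le_trans (oppr_cube_le_tetragamma_bound x0 (ltW xh)).
have := @log_cumulant3_lt_quartic _ (x + 1); rewrite log_cumulant3_add1//.
have : 0 <= quartic (x + 1).
  have x10 : 0 <= x + 1 by lra.
  by rewrite /quartic !addr_ge0 ?divr_ge0 ?mulr_ge0 ?exprn_ge0.
have xh1 : 2^-1 <= x + 1 by lra.
move=> q0 /(_ xh1); lra.
Qed.

Lemma trigamma_bound_le {R : realType} (x : R) : 1 <= x ->
  trigamma_bound x <= 2 / x.
Proof.
move=> x1; have x0 : 0 < x by lra.
have := expR_inv_subr1 x0; have := expR_inv_subr1_gt0 x0.
rewrite /trigamma_bound; move: (expR (1 / x)) => E E0.
rewrite ler_pdivrMr// => E1.
rewrite ler_pdivrMr ?mulr_gt0 ?exprn_gt0//.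
have -> : 2 / x * ((E - 1) * x ^+ 2) = 2 * ((E - 1) * x) by field; rewrite gt_eqF.
nra.
Qed.

(** The difference [F] has derivative [psi'' - tetragamma_bound < 0]. If it were
negative at [x + 1], it would stay below that value further on, contradicting
[F y >= - trigamma_bound y >= - 2/y]. *)
Lemma log_cumulant2_gt {R : realType} (x : R) : 0 < x ->
  trigamma_bound x < log_cumulant2 x.
Proof.
move=> x0; pose F (y : R) := log_cumulant2 y - trigamma_bound y.
have dF (y : R) : 0 < y -> is_derive y 1 F (log_cumulant3 y - tetragamma_bound y).
  move=> y0.
  exact: is_derive1B (is_derive_log_cumulant2 y0) (is_derive_trigamma_bound y0).
have Flt (a b : R) : 0 < a -> a < b -> F b < F a.
  move=> a0 ab.
  have [y||c] := MVT ab (df := fun y => log_cumulant3 y - tetragamma_bound y) (f := F).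
  - by rewrite in_itv/= => /andP[ay _]; apply: dF; exact: lt_trans ay.
  - apply: continuous_in_subspaceT => y; rewrite inE/= in_itv/= => /andP[ay _].
    exact: is_derive1_continuous (dF y (lt_le_trans a0 ay)).
  rewrite in_itv/= => /andP[ac cb] FE.
  have := log_cumulant3_lt (lt_trans a0 ac); rewrite -subr_lt0 => h.
  by rewrite -subr_lt0 FE nmulr_rlt0// subr_gt0.
suff F0 : 0 <= F (x + 1).
  by have := Flt x (x + 1) x0 (ltac:(lra)); rewrite /F in F0 *; lra.
rewrite leNgt; apply/negP => Fn.
have Fp : 0 < - F (x + 1) by rewrite oppr_gt0.
have [n nP] := exists_nat_ltr_div 2 Fp.
have n1 : 1 <= n.+1%:R :> R by rewrite ler1n.
set N := n.+1%:R in nP n1.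
set y := x + 1 + N.
have yN : N <= y by rewrite /y; lra.
have y0 : 0 < y by lra.
have xy : x + 1 < y by rewrite /y; lra.
have Fy : F y < F (x + 1) by apply: Flt xy; lra.
have by2 : trigamma_bound y <= 2 / y by apply: trigamma_bound_le; lra.
have yN2 : 2 / y <= 2 / N by rewrite ler_wpM2l// lef_pV2 ?posrE//; lra.
have : - (2 / N) <= F y.
  rewrite /F; have c2 := log_cumulant2_ge0 y0.
  apply: (@le_trans _ _ (0 - trigamma_bound y)); last by rewrite lerD2r.
  by rewrite sub0r lerN2 (le_trans by2).
move=> Fy2; have := le_lt_trans Fy2 Fy.
by rewrite ltrNl => /(lt_trans nP); rewrite ltxx.
Qed.

Theorem corollary1 (R : realType) (x : R) (hx : 0 < x) :
  ((@digamma R)^`())%classic x > expR (1 / x) / ((expR (1 / x) - 1) * x ^+ 2) /\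
  ((@digamma R)^`(2))%classic x <
    expR (1 / x) * (1 - 2 * x * (expR (1 / x) - 1)) /
      ((expR (1 / x) - 1) ^+ 2 * x ^+ 4).
Proof.
rewrite derive1_digamma// derive2_digamma//; split.
  exact: log_cumulant2_gt.
exact: log_cumulant3_lt.
Qed.
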